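(* Every split graph is spectrally threshold dominated.
   Context: All graphs are finite and simple. A split graph is a graph whose node set can be partitioned into two sets $A$ and $B$ such that $A$ induces a clique and $B$ induces no edge. For a graph $G$ on $n$ nodes, the Laplacian eigenvalues (eigenvalues of $L(G)=D(G)-A(G)$) are $\lambda_1(G)\ge\dots\ge\lambda_n(G)=0$. A threshold graph is a graph obtainable from the empty graph by repeatedly adding a new node that is either isolated or adjacent to all previously added nodes. A graph $G$ on $n$ nodes with $m$ edges is spectrally threshold dominated if for each $k\in\{1,\dots,n\}$ there is a threshold graph $T_k$ on $n$ nodes with $m$ edges satisfying $\sum_{i=1}^k\lambda_i(T_k)\ge\sum_{i=1}^k\lambda_i(G)$. *)

(* Defs.v *)
From HB Require Import structures.
From mathcomp Require Import all_boot all_order all_algebra.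
Set Implicit Arguments. Unset Strict Implicit. Unset Printing Implicit Defensive.
Import Order.TTheory GRing.Theory Num.Theory.
Local Open Scope ring_scope.

(* A finite simple graph on the n nodes 'I_n is a symmetric irreflexive
   relation e : rel 'I_n (these two properties are assumed explicitly). *)

Definition num_edges (n : nat) (e : rel 'I_n) : nat :=
  #|[set p : 'I_n * 'I_n | (p.1 < p.2)%N && e p.1 p.2]|.

Definition deg (n : nat) (e : rel 'I_n) (i : 'I_n) : nat := #|[set j | e i j]|.

Definition laplacian (R : nzRingType) (n : nat) (e : rel 'I_n) : 'M[R]_n :=
  \matrix_(i, j) (if i == j then (deg e i)%:R else - (e i j)%:R).

(* s is the list of Laplacian eigenvalues lambda_1 >= ... >= lambda_n of G
   (with multiplicity, in non-increasing order): the characteristic polynomial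
   of L(G) splits as prod (X - s_i). Such a list exists and is unique. *)
Definition lap_spectrum (R : rcfType) (n : nat) (e : rel 'I_n) (s : seq R) :=
  [/\ size s = n,
      sorted (fun x y => y <= x) s &
      char_poly (laplacian R e) = \prod_(x <- s) ('X - x%:P)].

Definition is_split (n : nat) (e : rel 'I_n) : Prop :=
  exists A : {set 'I_n},
    (forall x y, x \in A -> y \in A -> x != y -> e x y) /\
    (forall x y, x \notin A -> y \notin A -> ~~ e x y).

(* threshold graph: nodes are added one at a time in the order given by the
   injective position map pos; node x is added either isolated (b x = false)
   or adjacent to all previously added nodes (b x = true). Hence two distinct
   nodes are adjacent iff the later-added one was added as dominating. *)
Definition is_threshold (n : nat) (e : rel 'I_n) : Prop :=
  exists (pos : 'I_n -> nat) (b : 'I_n -> bool),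
    injective pos /\
    forall x y, e x y = (x != y) && (if (pos x < pos y)%N then b y else b x).

(* Main.v *)
Require Import Defs.
From HB Require Import structures.
From mathcomp Require Import boolp classical_sets reals topology normedtype.
From mathcomp Require Import sequences Rstruct.
From mathcomp Require Import all_boot all_order all_algebra perm.
From mathcomp Require Import ring lra zify.
Set Implicit Arguments. Unset Strict Implicit. Unset Printing Implicit Defensive.
Import Order.TTheory GRing.Theory Num.Theory.
Import numFieldNormedType.Exports.
Local Open Scope ring_scope.

(* Let G be split with clique A, |A| = a, and r edges between A and the rest, so that
   m = r + a(a-1)/2. Among threshold graphs with n nodes and m edges the largest
   possible sum of k Laplacian eigenvalues is the minimum of nk, 2m and m + k(k+1)/2.
   The first two bounds hold for every graph, and the third follows from
       sum_i max(lambda_i - a, 0) <= r.                                          (1)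
   Write N for the adjacency matrix between A and its complement B, Nb = J - N,
   D and E for the diagonal matrices of row and column sums of N. Adding a
   rank-one matrix to L - aI, which only moves the eigenvalue -a to 0, gives
       K = [[D, Nb], [-N^T, E - aI]].
   If Y solves the Riccati equation  Y D + (aI - E) Y = N^T + Y Nb Y,  then K is
   similar to a block triangular matrix with diagonal blocks D - Nb Y and
   E - aI + Y Nb. For the minimal nonnegative solution Y, both D - Nb Y and
   aI - E - Y Nb are M-matrices, so the positive eigenvalues of K add up to at most
   tr (D - Nb Y) <= tr D = r.
   The solution Y is a limit, so this argument takes place in the real numbers. The
   spectrum over another real closed field is moved there by taking standard parts;
   nothing is lost because algebraic numbers are never infinitesimal. *)

(** * M-matrices and characteristic polynomials *)

Lemma det_schur1 (F : fieldType) (n : nat) (c : F) (u : 'rV[F]_n) (v : 'cV[F]_n)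
    (B : 'M[F]_n) : c != 0 ->
  \det (block_mx c%:M u v B) = c * \det (B - c^-1 *: (v *m u)).
Proof.
move=> c0.
have E : block_mx 1%:M 0 (- (c^-1 *: v)) 1%:M *m block_mx c%:M u v B
         = block_mx c%:M u 0 (B - c^-1 *: (v *m u)).
  rewrite mulmx_block !mul1mx !mul0mx !addr0 mulNmx mul_mx_scalar scalerA mulfV //.
  by rewrite scale1r addNr mulNmx -scalemxAl addrC.
have := congr1 determinant E.
by rewrite det_mulmx det_lblock !det1 !mul1r det_ublock det_scalar1.
Qed.

(* Gaussian elimination preserves both the sign pattern and the weighted column-sum condition. *)
Lemma det_mmatrix_ge (F : realFieldType) (n : nat) (T : 'M[F]_n) (w : 'I_n -> F)
    (x : F) : 0 < x -> (forall i, 0 < w i) ->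
  (forall i j, i != j -> T i j <= 0) ->
  (forall j, 0 <= \sum_i w i * T i j) ->
  x ^+ n <= \det (x%:M + T).
Proof.
move=> x0; elim: n T w => [|n IH] T w w0 offT colT.
  by rewrite det_mx00 expr0.
pose c := x + T 0 0.
have T00 : 0 <= T 0 0.
  have := colT 0; rewrite big_ord_recl => h.
  rewrite -(pmulr_rge0 _ (w0 0)); apply: le_trans h _.
  rewrite gerDl; apply: sumr_le0 => i _.
  by rewrite pmulr_rle0 // offT.
have c0 : 0 < c by rewrite /c ltr_wpDr.
pose u : 'rV[F]_n := \row_j T 0 (lift 0 j).
pose v : 'cV[F]_n := \col_i T (lift 0 i) 0.
pose B : 'M[F]_n := \matrix_(i, j) T (lift 0 i) (lift 0 j).
have -> : x%:M + T = block_mx (c%:M : 'M_1) u v (x%:M + B) :> 'M_(1 + n).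
  apply/matrixP => i j; rewrite !mxE.
  case: splitP => i' Ei; rewrite !mxE; case: splitP => j' Ej; rewrite !mxE.
  - have -> : i = 0 by apply/val_inj; rewrite /= Ei ord1.
    have -> : j = 0 by apply/val_inj; rewrite /= Ej ord1.
    by rewrite !ord1 /= mulr1n.
  - have -> : i = 0 by apply/val_inj; rewrite /= Ei ord1.
    have -> : j = lift 0 j' by apply/val_inj; rewrite /= Ej.
    by rewrite /= mulr0n add0r.
  - have -> : j = 0 by apply/val_inj; rewrite /= Ej ord1.
    have -> : i = lift 0 i' by apply/val_inj; rewrite /= Ei.
    by rewrite /= mulr0n add0r.
  - have -> : i = lift 0 i' by apply/val_inj; rewrite /= Ei.
    have -> : j = lift 0 j' by apply/val_inj; rewrite /= Ej.
    by rewrite (inj_eq lift_inj).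
rewrite det_schur1 ?gt_eqF // -addrA exprS.
apply: ler_pM => //; first exact: ltW.
- exact/exprn_ge0/ltW.
- by rewrite /c lerDl.
have Z i : T 0 (lift 0 i) <= 0 by apply: offT; rewrite neq_lift.
have Z' i : T (lift 0 i) 0 <= 0 by apply: offT; rewrite eq_sym neq_lift.
apply: (IH _ (fun i => w (lift 0 i))) => // [i j ij | j].
  rewrite !mxE big_ord1 !mxE subr_le0.
  apply: (@le_trans _ _ 0); first by apply: offT; rewrite (inj_eq lift_inj).
  by apply: mulr_ge0; [rewrite invr_ge0 ltW | rewrite mulr_le0].
have := colT (lift 0 j); rewrite big_ord_recl => h1.
have := colT 0; rewrite big_ord_recl => h2.
pose s1 := \sum_(i < n) w (lift 0 i) * T (lift 0 i) (lift 0 j).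
pose s2 := \sum_(i < n) w (lift 0 i) * T (lift 0 i) 0.
have -> : \sum_(i < n) w (lift 0 i) * (B - c^-1 *: (v *m u)) i j
     = s1 - c^-1 * T 0 (lift 0 j) * s2.
  rewrite /s2 mulr_sumr -sumrB; apply: eq_bigr => i _.
  by rewrite !mxE big_ord1 !mxE; ring.
rewrite -/s1 in h1; rewrite -/s2 in h2.
(* With pivot [c = x + T 0 0], add [- T 0 j / c] times the condition on column 0 to the condition on
   column [j]. Row 0 cancels up to a surplus [w 0 * x * (- T 0 j) / c], which is nonnegative. *)
have cc : c^-1 * c = 1 by rewrite mulVf ?gt_eqF.
have ci : 0 < c^-1 by rewrite invr_gt0.
have w00 := w0 0; have Zj := Z j.
have : 0 <= c^-1 * (- T 0 (lift 0 j)) * (w 0 * T 0 0 + s2).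
  by apply: mulr_ge0 => //; apply: mulr_ge0; [exact: ltW | rewrite oppr_ge0].
have : 0 <= c^-1 * (- T 0 (lift 0 j)) * (w 0 * x).
  apply: mulr_ge0; last by rewrite mulr_ge0 // ltW.
  by apply: mulr_ge0; [exact: ltW | rewrite oppr_ge0].
have : c^-1 * (- T 0 (lift 0 j)) * (w 0 * x) + c^-1 * (- T 0 (lift 0 j)) * (w 0 * T 0 0)
      = - T 0 (lift 0 j) * w 0.
  by rewrite -mulrDr -mulrDr -/c; rewrite -[RHS]mul1r -cc; ring.
rewrite !mulrDr; lra.
Qed.


Lemma horner_char_poly (F : comNzRingType) (n : nat) (T : 'M[F]_n) (x : F) :
  (char_poly T).[x] = \det (x%:M - T).
Proof.
rewrite /char_poly -horner_evalE -det_map_mx; congr (\det _).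
apply/matrixP => i j; rewrite !mxE /= horner_evalE hornerD hornerN hornerC.
by rewrite hornerMn hornerX.
Qed.

(** Two block eliminations of the bordered matrix [W], one clearing [u] and one clearing [c],
    compute its determinant in two ways. The factor [y] on the left avoids inverting [y]. *)
Lemma det_rank1 (D : idomainType) (n : nat) (y : D) (c : 'cV[D]_n) (u : 'rV[D]_n) :
  y * \det (y%:M - c *m u) = y ^+ n * (y - (u *m c) 0 0).
Proof.
pose W := block_mx y%:M c u (1%:M : 'M_1).
have E1 : W *m block_mx 1%:M 0 (- u) 1%:M = block_mx (y%:M - c *m u) c 0 1%:M.
  rewrite mulmx_block !mulmx1 !mulmx0 !mul1mx !mulmxN !add0r.
  by rewrite addrN.
have E2 : W *m block_mx 1%:M (- c) 0 y%:M = block_mx y%:M 0 u (y%:M - u *m c).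
  rewrite mulmx_block !mulmx1 !mulmx0 !mul1mx !mulmxN !addr0.
  by rewrite mul_scalar_mx mul_mx_scalar addNr addrC.
have := congr1 determinant E1; have := congr1 determinant E2.
rewrite !det_mulmx !det_lblock !det_ublock !det1 !mulr1 !det_scalar expr1 !mul1r.
move=> h2 <-; rewrite mulrC h2; congr (_ * _).
by rewrite [LHS]det_mx11 !mxE mulr1n.
Qed.

(** Since [u] is a left eigenvector, [(X - mu)(X - M - c u) = ((X - mu) - c u)(X - M)], and
    [det_rank1] evaluates the first factor on the right. So only the eigenvalue [mu] moves, to
    [mu + u c]. *)
Lemma char_poly_rank1 (D : idomainType) (n : nat) (M : 'M[D]_n) (c : 'cV[D]_n)
    (u : 'rV[D]_n) (mu : D) : u *m M = mu *: u ->
  char_poly (M + c *m u) * ('X - mu%:P)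
    = char_poly M * ('X - (mu + (u *m c) 0 0)%:P).
Proof.
move=> uM; set y := 'X - mu%:P.
have y0 : y != 0 by rewrite polyXsubC_eq0.
pose cp := map_mx polyC c; pose up := map_mx polyC u.
have upM : up *m char_poly_mx M = y *: up.
  rewrite /char_poly_mx mulmxBr -map_mxM uM map_mxZ /= mul_mx_scalar.
  by rewrite /y scalerBl.
have E : y%:M *m char_poly_mx (M + c *m u) = (y%:M - cp *m up) *m char_poly_mx M.
  rewrite mulmxBl -mulmxA upM -scalemxAr /char_poly_mx map_mxD /= map_mxM.
  by rewrite opprD addrA mulmxBr mul_scalar_mx [in X in _ - X]mul_scalar_mx.
have := congr1 determinant E; rewrite !det_mulmx det_scalar => h.
apply: (mulfI (expf_neq0 n y0)).
rewrite mulrA h -mulrA mulrC -mulrA det_rank1.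
rewrite mulrCA; congr (_ * (_ * _)).
have -> : (up *m cp) 0 0 = ((u *m c) 0 0)%:P.
  by rewrite -map_mxM mxE.
by rewrite /y polyCD opprD addrA.
Qed.

(** This renumbers nodes between index types of different form, such as ['I_(a + b)] and ['I_n]. *)
Lemma char_poly_mxsub (D : comNzRingType) (n p : nat) (h : 'I_p -> 'I_n) (M : 'M[D]_n) :
  bijective h -> char_poly (mxsub h h M) = char_poly M.
Proof.
move=> bij_h; have E : p = n by rewrite -(card_ord n) -(bij_eq_card bij_h) card_ord.
subst p; pose s := perm (bij_inj bij_h).
have -> : char_poly (mxsub h h M) = \det (row_perm s (col_perm s (char_poly_mx M))).
  congr (\det _); apply/matrixP => i j; rewrite !mxE !permE.
  by rewrite (inj_eq (bij_inj bij_h)).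
rewrite row_permE col_permE !det_mulmx !det_perm odd_permV.
by rewrite mulrCA -expr2 sqrr_sign mulr1.
Qed.

Lemma sum_roots_char_poly (D : comNzRingType) (n : nat) (M : 'M[D]_n) (s : seq D) :
  char_poly M = \prod_(z <- s) ('X - z%:P) -> \sum_(z <- s) z = \tr M.
Proof.
move=> E; have sz : size s = n.
  by have := size_char_poly M; rewrite E size_prod_XsubC => -[].
case: n M E sz => [|n] M E sz.
  by rewrite (size0nil sz) big_nil /mxtrace big_ord0.
apply: oppr_inj; rewrite -coefPn_prod_XsubC ?sz // -E.
by rewrite char_poly_trace.
Qed.

Lemma root_char_poly_ge0 (F : realFieldType) (n : nat) (T : 'M[F]_n) (z : F) :
  (forall x, 0 < x -> 0 < \det (x%:M + T)) -> root (char_poly T) z -> 0 <= z.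
Proof.
move=> h; rewrite leNgt /root horner_char_poly; apply: contraTN => z0.
have -> : z%:M - T = - ((- z)%:M + T) by rewrite raddfN opprD opprK.
rewrite -scaleN1r detZ mulf_neq0 ?signr_eq0 // gt_eqF // h //.
by rewrite oppr_gt0.
Qed.

Lemma root_char_poly_le0 (F : realFieldType) (n : nat) (T : 'M[F]_n) (z : F) :
  (forall x, 0 < x -> 0 < \det (x%:M - T)) -> root (char_poly T) z -> z <= 0.
Proof.
move=> h; rewrite leNgt /root horner_char_poly; apply: contraTN => z0.
by rewrite gt_eqF // h.
Qed.

(** * The Riccati iteration *)

Section Riccati.
Variables (F : realFieldType) (a b : nat) (N : 'I_a -> 'I_b -> bool).

Definition rdeg (i : 'I_a) : F := \sum_j (N i j)%:R.
Definition cdeg (j : 'I_b) : F := \sum_i (N i j)%:R.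
Definition nonadj : 'M[F]_(a, b) := \matrix_(i, j) (~~ N i j)%:R.
(** The coefficient of [Y j i] on the left of the Riccati equation, [D] and [E] being diagonal.
    Dividing by it turns the solutions into the fixed points of [riccati]. *)
Definition gap (i : 'I_a) (j : 'I_b) : F := a%:R + rdeg i - cdeg j.
Definition riccati (Y : 'M[F]_(b, a)) : 'M[F]_(b, a) :=
  \matrix_(j, i) (((N i j)%:R + (Y *m nonadj *m Y) j i) / gap i j).
Definition csum (Y : 'M[F]_(b, a)) (i : 'I_a) : F := \sum_j Y j i.

(* The factor [1 - 1/(t+1)] keeps all column sums strictly below 1. *)
Fixpoint riccati_iter (t : nat) : 'M[F]_(b, a) :=
  if t is t'.+1 then (1 - t'.+1%:R^-1) *: riccati (riccati_iter t') else 0.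

Lemma nonadj_ge0 i j : 0 <= nonadj i j.
Proof. by rewrite mxE. Qed.

Lemma sum_nonadj j : \sum_i nonadj i j = a%:R - cdeg j.
Proof.
have -> : a%:R = \sum_(i < a) (1 : F) by rewrite sumr_const card_ord.
rewrite /cdeg -sumrB; apply: eq_bigr => i _; rewrite mxE.
by case: (N i j); rewrite /= ?subr0 ?subrr.
Qed.

Lemma rdeg_ge0 i : 0 <= rdeg i.
Proof. by apply: sumr_ge0 => j _. Qed.

(** [a - cdeg j] counts the clique nodes not adjacent to [j], and [rdeg i] the outside neighbours of
    [i]. The pair [(i, j)] itself contributes to one of the two counts. *)
Lemma gap_gt0 i j : 0 < gap i j.
Proof.
rewrite /gap -addrA addrCA -sum_nonadj.
have [Nij|Nij] := boolP (N i j).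
  apply: ltr_wpDr; first by apply: sumr_ge0 => k _; apply: nonadj_ge0.
  rewrite /rdeg (bigD1 j) //= Nij ltr_pwDl //.
  by apply: sumr_ge0.
apply: ltr_wpDl; first exact: rdeg_ge0.
rewrite (bigD1 i) //= mxE Nij ltr_pwDl //.
by apply: sumr_ge0 => k _; apply: nonadj_ge0.
Qed.

Lemma csum_mul3 (Y : 'M[F]_(b, a)) i :
  \sum_j (Y *m nonadj *m Y) j i = \sum_j (\sum_k csum Y k * nonadj k j) * Y j i.
Proof.
rewrite (eq_bigr _ (fun j _ => mxE _ _ j i)).
rewrite exchange_big /=; apply: eq_bigr => j _.
rewrite -mulr_suml; congr (_ * _).
rewrite (eq_bigr _ (fun l _ => mxE _ _ l j)).
rewrite exchange_big /=; apply: eq_bigr => k _.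
by rewrite -mulr_suml.
Qed.

Lemma gap_riccati Y i j :
  gap i j * riccati Y j i = (N i j)%:R + (Y *m nonadj *m Y) j i.
Proof. by rewrite mxE mulrC divfK // gt_eqF // gap_gt0. Qed.

Lemma sum_gap (Z : 'M[F]_(b, a)) i :
  \sum_j gap i j * Z j i = rdeg i * csum Z i + \sum_j (a%:R - cdeg j) * Z j i.
Proof.
by rewrite /csum mulr_sumr -big_split; apply: eq_bigr => j _ /=; rewrite /gap; ring.
Qed.

Lemma sum_gap_riccati Y i :
  \sum_j gap i j * riccati Y j i
    = rdeg i + \sum_j (\sum_k csum Y k * nonadj k j) * Y j i.
Proof.
under eq_bigr do rewrite gap_riccati.
by rewrite big_split /= csum_mul3.
Qed.

Definition topblock (Y : 'M[F]_(b, a)) : 'M[F]_a :=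
  diag_mx (\row_i rdeg i) - nonadj *m Y.

(** With weights [1 - csum Y], the column sums of [D - Nb Y] measure the defect [riccati Y - Y].
    They are therefore nonnegative for every subsolution [Y <= riccati Y]. *)
Lemma topblock_csum Y i :
  \sum_k (1 - csum Y k) * topblock Y k i = \sum_j gap i j * (riccati Y - Y) j i.
Proof.
have -> : \sum_j gap i j * (riccati Y - Y) j i
    = \sum_j gap i j * riccati Y j i - \sum_j gap i j * Y j i.
  by rewrite -sumrB; apply: eq_bigr => j _; rewrite !mxE; ring.
rewrite sum_gap_riccati sum_gap.
have -> : \sum_k (1 - csum Y k) * topblock Y k i
   = (1 - csum Y i) * rdeg i - \sum_k \sum_j (1 - csum Y k) * (nonadj k j * Y j i).
  have -> : (1 - csum Y i) * rdeg i
      = \sum_k (1 - csum Y k) * (rdeg k *+ (k == i)).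
    rewrite (bigD1 i) //= eqxx big1 ?addr0 // => k /negPf ->.
    by rewrite mulr0n mulr0.
  rewrite -sumrB; apply: eq_bigr => k _.
  by rewrite !mxE mulrBr -mulr_sumr.
rewrite exchange_big /= opprD addrA.
have -> : \sum_j \sum_k (1 - csum Y k) * (nonadj k j * Y j i)
   = \sum_j (a%:R - cdeg j) * Y j i
     - \sum_j (\sum_k csum Y k * nonadj k j) * Y j i.
  rewrite -sumrB; apply: eq_bigr => j _.
  rewrite -sum_nonadj -mulrBl -sumrB mulr_suml; apply: eq_bigr => k _.
  by ring.
ring.
Qed.

Lemma le_mulmx3 (Y Z : 'M[F]_(b, a)) :
  (forall j i, 0 <= Y j i) -> (forall j i, Y j i <= Z j i) ->
  forall j i, (Y *m nonadj *m Y) j i <= (Z *m nonadj *m Z) j i.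
Proof.
move=> Y0 YZ j i; rewrite !mxE; apply: ler_sum => k _.
have Z0 j' i' : 0 <= Z j' i' by apply: le_trans (YZ _ _).
rewrite ler_pM // ?mxE; first by apply: sumr_ge0 => l _; rewrite mulr_ge0 // nonadj_ge0.
by apply: ler_sum => l _; rewrite ler_wpM2r // nonadj_ge0.
Qed.

Lemma riccati_ge0 (Y : 'M[F]_(b, a)) : (forall j i, 0 <= Y j i) -> forall j i, 0 <= riccati Y j i.
Proof.
move=> Y0 j i; rewrite mxE; apply: divr_ge0; last exact/ltW/gap_gt0.
rewrite addr_ge0 // mxE sumr_ge0 // => k _; rewrite mulr_ge0 // mxE.
by rewrite sumr_ge0 // => l _; rewrite mulr_ge0 // nonadj_ge0.
Qed.

Lemma le_riccati (Y Z : 'M[F]_(b, a)) :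
  (forall j i, 0 <= Y j i) -> (forall j i, Y j i <= Z j i) ->
  forall j i, riccati Y j i <= riccati Z j i.
Proof.
move=> Y0 YZ j i; rewrite !mxE ler_pM2r ?invr_gt0 ?gap_gt0 // lerD2l.
by have := le_mulmx3 Y0 YZ j i; rewrite !mxE.
Qed.

Lemma theta_ge0 t : 0 <= 1 - t.+1%:R^-1 :> F.
Proof. by rewrite subr_ge0 invf_le1 ?ltr0n // ler1n. Qed.

Lemma theta_lt1 t : 1 - t.+1%:R^-1 < 1 :> F.
Proof. by rewrite ltrBlDr ltrDl invr_gt0 ltr0n. Qed.

Lemma riccati_iter_ge0 t j i : 0 <= riccati_iter t j i.
Proof.
elim: t j i => [|t IH] j i /=; first by rewrite mxE.
by rewrite mxE mulr_ge0 ?theta_ge0 // riccati_ge0.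
Qed.

Lemma riccati_iterS t j i : riccati_iter t j i <= riccati_iter t.+1 j i.
Proof.
elim: t j i => [|t IH] j i.
  by rewrite [X in X <= _]mxE; apply: riccati_iter_ge0.
rewrite [X in X <= _]mxE [X in _ <= X]mxE ler_pM ?theta_ge0 //.
- by apply: riccati_ge0 => ? ?; apply: riccati_iter_ge0.
- by rewrite lerD2l lerN2 lef_pV2 ?posrE ?ltr0n // ler_nat.
- by apply: le_riccati => // *; apply: riccati_iter_ge0.
Qed.

(** Each iterate lies below the next one, which is [riccati] of it times a factor below 1. So all
    iterates are subsolutions. *)
Lemma riccati_iter_sub t j i : riccati_iter t j i <= riccati (riccati_iter t) j i.
Proof.
apply: le_trans (riccati_iterS t j i) _.
rewrite [X in X <= _]mxE; apply: ler_piMl; last exact/ltW/theta_lt1.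
by apply: riccati_ge0 => *; apply: riccati_iter_ge0.
Qed.

(** Settles the clique nodes without outside neighbours, where the proof of [csum_lt1] cannot divide
    by [rdeg i]. *)
Lemma riccati_iter_col0 t i j : rdeg i = 0 -> riccati_iter t j i = 0.
Proof.
move=> di; have Ni k : N i k = false.
  apply/negP => Nik; move: di; rewrite /rdeg (bigD1 k) //= Nik => /eqP.
  by rewrite gt_eqF // ltr_pwDl // sumr_ge0.
elim: t j => [|t IH] j /=; first by rewrite mxE.
rewrite !mxE Ni add0r big1 ?mul0r ?mulr0 // => k _.
by rewrite IH mulr0.
Qed.

Lemma csum_ge0 t i : 0 <= csum (riccati_iter t) i.
Proof. by apply: sumr_ge0 => j _; apply: riccati_iter_ge0. Qed.

(** Summing the equation for [riccati Y] over [j] expresses [rdeg i * csum (riccati Y) i] as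
    [rdeg i] plus a quadratic term minus the sum of [(a - cdeg j) * riccati Y j i]. If all column
    sums of [Y] are at most 1, the quadratic term is at most the subtracted one, because
    [Y <= riccati Y]. Hence the new column sums are at most 1, and the damping factor makes them
    smaller than 1. *)
Lemma csum_lt1 t i : csum (riccati_iter t) i < 1.
Proof.
elim: t i => [|t IH] i /=.
  by rewrite /csum big1 // => j _; rewrite mxE.
have /orP[/eqP d0|d0] : (rdeg i == 0) || (0 < rdeg i).
  by rewrite -le0r rdeg_ge0.
- rewrite /csum big1 // => j _.
  by have := riccati_iter_col0 t.+1 j d0.
set Y := riccati_iter t in IH *.
have z1 : csum (riccati Y) i <= 1.
  rewrite -(ler_pM2l d0) mulr1.
  have := sum_gap (riccati Y) i; rewrite sum_gap_riccati => E.
  have : \sum_j (\sum_k csum Y k * nonadj k j) * Y j i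
      <= \sum_j (a%:R - cdeg j) * riccati Y j i.
    apply: ler_sum => j _; rewrite -sum_nonadj.
    have Yj : 0 <= Y j i by apply: riccati_iter_ge0.
    apply: ler_pM => //; last exact: riccati_iter_sub.
      by apply: sumr_ge0 => k _; rewrite mulr_ge0 ?nonadj_ge0 // csum_ge0.
    apply: ler_sum => k _; rewrite ler_piMl ?nonadj_ge0 //.
    exact: ltW.
  by move: E; lra.
have -> : csum ((1 - t.+1%:R^-1) *: riccati Y) i = (1 - t.+1%:R^-1) * csum (riccati Y) i.
  by rewrite /csum mulr_sumr; apply: eq_bigr => j _; rewrite mxE.
apply: le_lt_trans (theta_lt1 t).
by rewrite ler_piMr // theta_ge0.
Qed.

Lemma topblock_offdiag (Y : 'M[F]_(b, a)) : (forall j i, 0 <= Y j i) ->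
  forall i k, i != k -> topblock Y i k <= 0.
Proof.
move=> Y0 i k /negPf ik; rewrite !mxE ik mulr0n sub0r oppr_le0.
by apply: sumr_ge0 => j _; rewrite mulr_ge0 // nonadj_ge0.
Qed.

(** Here the strict inequality [csum < 1] matters: the weights [1 - csum] must be positive. In the
    limit they may vanish, but the determinant bound survives. *)
Lemma det_topblock_iter t x : 0 < x ->
  x ^+ a <= \det (x%:M + topblock (riccati_iter t)).
Proof.
move=> x0; apply: (@det_mmatrix_ge _ _ _ (fun i => 1 - csum (riccati_iter t) i)) => //.
- by move=> i; rewrite subr_gt0 csum_lt1.
- by apply: topblock_offdiag => *; apply: riccati_iter_ge0.
- move=> i; rewrite topblock_csum; apply: sumr_ge0 => j _.
  apply: mulr_ge0; first exact/ltW/gap_gt0.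
  by have := riccati_iter_sub t j i; rewrite -subr_ge0 !mxE.
Qed.

End Riccati.

(** * The minimal solution of the Riccati equation *)

Section Limits.
Local Open Scope classical_set_scope.
Variable R : realType.

Lemma cvgn_sum (I : finType) (f : I -> nat -> R) (l : I -> R) :
  (forall i, f i t @[t --> \oo] --> l i) ->
  \sum_i f i t @[t --> \oo] --> \sum_i l i.
Proof. by move=> h; apply: cvg_big => //; exact: add_continuous. Qed.

Lemma cvgn_prod (I : finType) (f : I -> nat -> R) (l : I -> R) :
  (forall i, f i t @[t --> \oo] --> l i) ->
  \prod_i f i t @[t --> \oo] --> \prod_i l i.
Proof. by move=> h; apply: cvg_big => //; exact: mul_continuous. Qed.

Lemma cvgn_mulmx (m n p : nat) (A : nat -> 'M[R]_(m, n)) (B : nat -> 'M[R]_(n, p))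
    (A' : 'M[R]_(m, n)) (B' : 'M[R]_(n, p)) :
  (forall i j, A t i j @[t --> \oo] --> A' i j) ->
  (forall i j, B t i j @[t --> \oo] --> B' i j) ->
  forall i j, (A t *m B t) i j @[t --> \oo] --> (A' *m B') i j.
Proof.
move=> hA hB i j; under eq_fun do rewrite mxE.
by rewrite mxE; apply: cvgn_sum => k; exact: cvgM.
Qed.

Lemma cvgn_det (n : nat) (A : nat -> 'M[R]_n) (A' : 'M[R]_n) :
  (forall i j, A t i j @[t --> \oo] --> A' i j) ->
  \det (A t) @[t --> \oo] --> \det A'.
Proof.
move=> hA; rewrite /determinant; apply: cvgn_sum => s.
by apply: cvgMr; apply: cvgn_prod => i; exact: hA.
Qed.

(** The iterates increase and have entries at most 1, so they converge entrywise. Weak inequalities,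
    the determinant bound among them, pass to the limit. *)
Lemma riccati_solution (a b : nat) (N : 'I_a -> 'I_b -> bool) :
  exists Y : 'M[R]_(b, a), [/\ forall j i, 0 <= Y j i, forall i, csum Y i <= 1,
    riccati N Y = Y & forall x, 0 < x -> x ^+ a <= \det (x%:M + topblock N Y)].
Proof.
pose u t := riccati_iter R N t.
have u_le1 t j i : u t j i <= 1.
  apply: le_trans (ltW (csum_lt1 R N t i)).
  rewrite /csum (bigD1 j) //= lerDl; apply: sumr_ge0 => k _.
  exact: riccati_iter_ge0.
have u_cvg j i : cvgn (fun t => u t j i).
  apply: nondecreasing_is_cvgn.
    by apply/nondecreasing_seqP => t; exact: riccati_iterS.
  by exists 1 => _ [t _ <-]; exact: u_le1.
pose Y : 'M[R]_(b, a) := \matrix_(j, i) limn (fun t => u t j i).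
have cY j i : u t j i @[t --> \oo] --> Y j i by rewrite mxE; exact: u_cvg.
have Y0 j i : 0 <= Y j i.
  by apply: cvgr_to_ge (cY j i) _; near=> t; exact: riccati_iter_ge0.
exists Y; split => //.
- move=> i; have : csum (u t) i @[t --> \oo] --> csum Y i by exact: cvgn_sum.
  by move/cvgr_to_le; apply; near=> t; exact/ltW/csum_lt1.
- have cN i j : (fun=> nonadj R N) t i j @[t --> \oo] --> nonadj R N i j by exact: cvg_cst.
  (* The damping factor tends to 1, so the shifted sequence converges to [riccati N Y]; it also
     converges to [Y]. *)
  have cR j i : u t.+1 j i @[t --> \oo] --> riccati N Y j i.
    rewrite -[riccati N Y j i]mul1r.
    have -> : (fun t => u t.+1 j i) = (fun t => (1 - t.+1%:R^-1) * riccati N (u t) j i).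
      by apply/funext => t; rewrite /u /= mxE.
    apply: cvgM.
      rewrite -[X in _ --> X]subr0; apply: cvgB; first exact: cvg_cst.
      exact: cvg_harmonic.
    under eq_fun do rewrite mxE; rewrite mxE; apply: cvgMl.
    apply: cvgD; first exact: cvg_cst.
    by apply: cvgn_mulmx => //; apply: cvgn_mulmx.
  apply/matrixP => j i; have := cY j i; rewrite -cvg_shiftS => cS.
  by rewrite -(cvg_lim _ cS) // -(cvg_lim _ (cR j i)).
- move=> x x0.
  have cD : \det (x%:M + topblock N (u t)) @[t --> \oo] --> \det (x%:M + topblock N Y).
    apply: cvgn_det => i k.
    have E Z : (x%:M + topblock N Z) i k
      = (x%:M + diag_mx (\row_i rdeg R N i)) i k - (nonadj R N *m Z) i k.
      by rewrite addrA !mxE.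
    under eq_fun do rewrite E; rewrite E; apply: cvgB; first exact: cvg_cst.
    by apply: cvgn_mulmx => // ? ?; exact: cvg_cst.
  apply: cvgr_to_ge cD _; near=> t; exact: det_topblock_iter.
Unshelve. all: by end_near.
Qed.

End Limits.

(** * Laplacians of split graphs, in block form *)

Lemma char_poly_conj (D : idomainType) (n : nat) (P A B : 'M[D]_n) :
  \det P = 1 -> P *m A = B *m P -> char_poly A = char_poly B.
Proof.
move=> dP PA; pose Q := map_mx polyC P.
have dQ : \det Q = 1 by rewrite det_map_mx dP.
have : Q *m char_poly_mx A = char_poly_mx B *m Q.
  by rewrite /char_poly_mx mulmxBr mulmxBl -!map_mxM PA scalar_mxC.
by move/(congr1 determinant); rewrite !det_mulmx dQ mul1r mulr1.
Qed.

Lemma char_poly_ublock (D : comNzRingType) (m n : nat) (A : 'M[D]_m) (B : 'M[D]_(m, n))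
    (C : 'M[D]_n) :
  char_poly (block_mx A B 0 C) = char_poly A * char_poly C.
Proof.
rewrite /char_poly -(det_ublock _ (- map_mx polyC B)); congr (\det _).
rewrite /char_poly_mx map_block_mx map_mx0 scalar_mx_block opp_block_mx add_block_mx.
by rewrite oppr0 !add0r.
Qed.

(** Lets the two diagonal blocks inherit real roots from the product of their characteristic
    polynomials. *)
Lemma dvdp_split (F : fieldType) (p : {poly F}) (s : seq F) : p \is monic ->
  p %| \prod_(z <- s) ('X - z%:P) -> exists r, p = \prod_(z <- r) ('X - z%:P).
Proof.
move=> mp /dvdp_prod_XsubC[m]; rewrite eqp_monic ?monic_prod_XsubC //.
by move/eqP => ->; exists (mask m s).
Qed.

Section SplitLaplacian.
Variables (F : comNzRingType) (a b : nat) (N : 'I_a -> 'I_b -> bool).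

(** Clique nodes come first. The diagonal of the clique block works out to [a - 1] plus the number
    of outside neighbours. *)
Definition split_laplacian : 'M[F]_(a + b) :=
  block_mx (a%:R%:M - const_mx 1 + diag_mx (\row_i \sum_j (N i j)%:R))
           (- \matrix_(i, j) (N i j)%:R)
           (- \matrix_(j, i) (N i j)%:R)
           (diag_mx (\row_j \sum_i (N i j)%:R)).

Lemma split_laplacian_ones : const_mx 1 *m split_laplacian = 0 :> 'rV_(a + b).
Proof.
have -> : const_mx 1 = row_mx (const_mx 1) (const_mx 1) :> 'rV[F]_(a + b).
  by rewrite row_mx_const.
rewrite mul_row_block -row_mx0 !mulmxDr !mulmxN mul_mx_scalar !mul_mx_diag.
congr row_mx; apply/matrixP => i0 i; rewrite !mxE.
  rewrite (_ : \sum_k _ * _ = a%:R); last first.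
    by rewrite -[a in RHS]card_ord -sumr_const; apply: eq_bigr => k _; rewrite !mxE mulr1.
  rewrite mulr1 subrr add0r mul1r -sumrB big1 // => j _.
  by rewrite !mxE mul1r subrr.
rewrite mul1r addrC -sumrB big1 // => j _.
by rewrite !mxE mul1r subrr.
Qed.

End SplitLaplacian.

Lemma split_laplacian_bound (R : realType) (a b : nat) (N : 'I_a -> 'I_b -> bool) (s : seq R) :
  char_poly (split_laplacian R N) = \prod_(z <- s) ('X - z%:P) ->
  \sum_(z <- s) Num.max (z - a%:R) 0 <= \sum_i \sum_j (N i j)%:R.
Proof.
move=> Es; have [Y [Y0 Y1 EY dY]] := riccati_solution R N.
(* [c] is the indicator of the clique, so [c u] adds 1 to every entry in the clique rows. This moves
   the eigenvalue 0 of the Laplacian to [u c = a]. The blocks [A1] and [A2] are those of the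
   overview shifted by [a]. *)
pose u : 'rV[R]_(a + b) := const_mx 1.
pose c : 'cV[R]_(a + b) := col_mx (const_mx 1) 0.
pose D := diag_mx (\row_i rdeg R N i).
pose E := diag_mx (\row_j cdeg R N j).
pose Nt : 'M[R]_(b, a) := \matrix_(j, i) (N i j)%:R.
pose A1 := topblock N Y + a%:R%:M.
pose A2 := E + Y *m nonadj R N.
have EK : split_laplacian R N + c *m u
    = block_mx (a%:R%:M + D) (nonadj R N) (- Nt) E.
  have -> : u = row_mx (const_mx 1) (const_mx 1) by rewrite row_mx_const.
  rewrite mul_col_row !mul0mx add_block_mx !addr0.
  have J m : (const_mx 1 : 'cV_a) *m const_mx 1 = const_mx 1 :> 'M[R]_(a, m).
    by apply/matrixP => i j; rewrite !mxE big_ord1 !mxE mulr1.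
  congr block_mx; first by rewrite J addrAC subrK.
  rewrite J; apply/matrixP => i j; rewrite !mxE.
  by case: (N i j); rewrite /= ?addNr ?oppr0 ?add0r.
have EA : char_poly (split_laplacian R N + c *m u) = char_poly A1 * char_poly A2.
  rewrite -(char_poly_ublock A1 (nonadj R N)) EK.
  apply: (@char_poly_conj _ _ (block_mx 1%:M 0 Y 1%:M)).
    by rewrite det_lblock !det1 mulr1.
  rewrite !mulmx_block !mul1mx !mul0mx !mulmx1 !mulmx0 !addr0 !add0r.
  congr block_mx.
  - by rewrite /A1 /topblock -/D addrAC subrK addrC.
  (* The lower left block vanishes exactly by the Riccati equation. *)
  - rewrite /A2 mulmxDl mulmxDr mul_mx_scalar mul_mx_diag mul_diag_mx.
    apply/matrixP => j i; have := gap_riccati N Y i j; rewrite EY /gap !mxE.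
    lra.
  - by rewrite addrC.
have := char_poly_rank1 c (mu := 0) (M := split_laplacian R N) (u := u).
rewrite split_laplacian_ones scale0r => /(_ erefl).
have -> : (u *m c) 0 0 = a%:R.
  have -> : u = row_mx (const_mx 1) (const_mx 1) by rewrite row_mx_const.
  rewrite mul_row_col mulmx0 addr0 !mxE.
  by under eq_bigr do rewrite !mxE mulr1; rewrite sumr_const card_ord.
rewrite EA add0r Es => Eq.
(* The roots of [A1], those of [A2] and one 0 together are [a] and the list [s]. *)
have Eq' : char_poly A1 * (char_poly A2 * ('X - 0%:P))
    = \prod_(z <- a%:R :: s) ('X - z%:P) by rewrite mulrA Eq big_cons mulrC.
have m1 : char_poly A1 \is monic by apply: char_poly_monic.
have m2 : char_poly A2 * ('X - 0%:P) \is monic.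
  by rewrite monicMr ?monicXsubC // char_poly_monic.
have [|r1 Er1] := dvdp_split (s := a%:R :: s) m1; first by rewrite -Eq' dvdp_mulr.
have [|r2 Er2] := dvdp_split (s := a%:R :: s) m2; first by rewrite -Eq' dvdp_mull.
have /prod_XsubC_eq pr : \prod_(z <- r1 ++ r2) ('X - z%:P)
    = \prod_(z <- a%:R :: s) ('X - z%:P).
  by rewrite big_cat /= -Er1 -Er2.
have r1a z : z \in r1 -> 0 <= z - a%:R.
  move=> zr; apply: (@root_char_poly_ge0 _ _ (topblock N Y)).
    by move=> x x0; apply: lt_le_trans (dY _ x0); rewrite exprn_gt0.
  have : root (char_poly A1) z by rewrite Er1 root_prod_XsubC.
  by rewrite /root !horner_char_poly raddfB /= /A1 opprD addrA addrAC.
have r2a z : z \in r2 -> z - a%:R <= 0.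
  move=> zr; have : root (char_poly A2 * ('X - 0%:P)) z by rewrite Er2 root_prod_XsubC.
  rewrite rootM root_XsubC => /orP[rz|/eqP->]; last by rewrite sub0r oppr_le0.
  apply: (@root_char_poly_le0 _ _ (A2 - a%:R%:M)); last first.
    move: rz; rewrite /root !horner_char_poly.
    by rewrite raddfB /= opprB addrA subrK.
  move=> x x0; apply: lt_le_trans (exprn_gt0 b x0) _.
  (* With unit weights, column [j] of [a - A2] sums to the sum of [(1 - csum Y k) * nonadj k j] over
     [k], which is nonnegative as [csum Y <= 1]. *)
  apply: (@det_mmatrix_ge _ _ _ (fun=> 1)) => //.
    move=> i j /negPf ij; rewrite !mxE ij !mulr0n add0r subr0 oppr_le0.
    by apply: sumr_ge0 => k _; rewrite mulr_ge0 // nonadj_ge0.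
  move=> j; have -> : \sum_i 1 * (- (A2 - a%:R%:M)) i j
      = (a%:R - cdeg R N j) - \sum_i (Y *m nonadj R N) i j.
    have -> : a%:R - cdeg R N j = \sum_i ((a%:R - cdeg R N i) *+ (i == j)).
      by rewrite (bigD1 j) //= eqxx big1 ?addr0 // => i /negPf ->.
    rewrite -sumrB; apply: eq_bigr => i _; rewrite !mxE mul1r.
    by case: (i == j); rewrite ?mulr1n ?mulr0n; ring.
  rewrite -sum_nonadj subr_ge0 (eq_bigr _ (fun l _ => mxE _ _ l j)).
  rewrite exchange_big /=; apply: ler_sum => k _.
  rewrite -mulr_suml ler_piMl ?nonadj_ge0 //; exact: Y1.
have Er1' : \sum_(z <- r1) z = \tr A1 by apply: sum_roots_char_poly.
have sz1 : size r1 = a.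
  by have := size_char_poly A1; rewrite Er1 size_prod_XsubC => -[].
have -> : \sum_(z <- s) Num.max (z - a%:R) 0 = \sum_(z <- a%:R :: s) Num.max (z - a%:R) 0.
  by rewrite big_cons subrr maxxx add0r.
(* Only the [a] roots of [A1] can exceed [a], so the sum is [tr A1 - a * a = tr (D - Nb Y)]. *)
rewrite -(perm_big _ pr) /= big_cat /= [X in _ + X]big1_seq; last first.
  by move=> z /andP[_ zr]; apply: max_r; exact: r2a.
rewrite addr0 (eq_big_seq (fun z => z - a%:R)); last first.
  by move=> z zr; apply: max_l; exact: r1a.
rewrite big_split /= sumrN Er1' big_const_seq count_predT sz1 iter_addr_0.
rewrite /A1 mxtraceD mxtrace_scalar addrK /topblock raddfB /= mxtrace_diag.
rewrite (eq_bigr (rdeg R N)); last by move=> i _; rewrite mxE.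
rewrite gerDl oppr_le0; apply: sumr_ge0 => i _; rewrite mxE.
by apply: sumr_ge0 => j _; rewrite mulr_ge0 // nonadj_ge0.
Qed.

(** * Standard parts *)

Section Algebraic.
Variable K : realFieldType.

Lemma rat_poly_bounded (p : {poly rat}) : exists2 C : rat, 0 <= C &
  forall x : K, 0 <= x <= 1 -> `|(map_poly ratr p).[x]| <= ratr C.
Proof.
elim/poly_ind: p => [|p c [C C0 hC]].
  by exists 0 => // x _; rewrite !rmorph0 horner0 normr0.
exists (C + `|c|) => [|x x01]; first by rewrite addr_ge0.
rewrite rmorphD rmorphM /= map_polyX map_polyC hornerMXaddC rmorphD /= ratr_norm.
apply: le_trans (ler_normD _ _) _; rewrite lerD2r normrM.
apply: le_trans (hC x x01); apply: ler_piMr => //.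
by case/andP: x01 => x0 x1; rewrite ger0_norm.
Qed.

(** Remove the powers of [X] from the polynomial, so that its constant term [c] is nonzero. For a
    root [x] in [(0, 1]] the other terms are bounded by [C * x], so [x] is at least [|c| / C]. *)
Lemma algebraic_rat_lower_bound (x : K) : algebraicOver (ratr : rat -> K) x -> 0 < x ->
  exists2 q : rat, 0 < q & ratr q < x.
Proof.
move=> [p p0 rp] x0.
have [m [q /implyP/(_ p0) q0 Ep]] := multiplicity_XsubC p 0.
have rq : root (map_poly ratr q) x.
  move: rp; rewrite Ep subr0 rmorphM rmorphXn /= map_polyX rootM => /orP[] //.
  by rewrite /root hornerXn expf_eq0 gt_eqF // andbF.
elim/poly_ind: q {Ep} q0 rq => [|q c _].
  by rewrite root0.
rewrite /root hornerMXaddC mulr0 add0r => c0.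
rewrite rmorphD rmorphM /= map_polyX map_polyC hornerMXaddC => rq.
have [C C0 hC] := rat_poly_bounded q.
have [x1|x1] := ltP 1 x; first by exists 1 => //; rewrite rmorph1.
have hx : `|ratr c| <= ratr C * x :> K.
  move: rq; rewrite addrC addr_eq0 => /eqP ->; rewrite normrN normrM.
  by rewrite (gtr0_norm x0) ler_pM2r // hC // x1 ltW.
have C1 : 0 < C + 1 by rewrite ltr_wpDl.
exists (`|c| / (C + 1)); first by rewrite divr_gt0 ?normr_gt0.
rewrite fmorph_div /= ltr_pdivrMr; last by rewrite ltr0q.
rewrite ratr_norm; apply: le_lt_trans hx _.
by rewrite mulrC ltr_pM2l // ltr_rat ltrDl.
Qed.

End Algebraic.

Section StandardPart.
Variables (K : realFieldType) (R : realType).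

(** [y] is the standard part of [x]. The two fields may have only the rationals in common, so
    closeness is expressed through common rational approximations. *)
Definition std_part (x : K) (y : R) : Prop := forall eps : rat, 0 < eps ->
  exists q : rat, `|x - ratr q| <= ratr eps /\ `|y - ratr q| <= ratr eps.

Lemma std_part_rat (q : rat) : std_part (ratr q) (ratr q).
Proof. by move=> eps e0; exists q; rewrite !subrr !normr0 !ler0q ltW. Qed.

Lemma std_partD x x' y y' : std_part x y -> std_part x' y' ->
  std_part (x + x') (y + y').
Proof.
move=> h h' eps e0; have e2 : 0 < eps / 2%:R by rewrite divr_gt0.
have [q [hx hy]] := h _ e2; have [q' [hx' hy']] := h' _ e2.
have E : eps = eps / 2%:R + eps / 2%:R by rewrite -splitr.
by exists (q + q'); rewrite {1 2}E !rmorphD /= !opprD !(addrACA _ _ (- ratr q));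
  split; apply: le_trans (ler_normD _ _) _; apply: lerD.
Qed.

Lemma std_partN x y : std_part x y -> std_part (- x) (- y).
Proof.
move=> h eps e0; have [q [hx hy]] := h _ e0; exists (- q).
by rewrite rmorphN /= -[X in `|X|]opprD normrN -[X in _ /\ `|X| <= _]opprD normrN rmorphN.
Qed.

Lemma norm_mul_sub (F : realFieldType) (x x' q q' C C' d e : F) :
  `|x| <= C -> `|x'| <= C' -> `|x - q| <= d -> `|x' - q'| <= d ->
  d <= 1 -> d * (C + C' + 1) <= e -> `|x * x' - q * q'| <= e.
Proof.
move=> xC xC' hx hx' d1; apply: le_trans.
have -> : x * x' - q * q' = x * (x' - q') + (x - q) * q' by ring.
apply: le_trans (ler_normD _ _) _; rewrite !normrM.
have hq' : `|q'| <= C' + 1.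
  have -> : q' = x' - (x' - q') by ring.
  by apply: le_trans (ler_normB _ _) _; apply: lerD => //; exact: le_trans d1.
rewrite -addrA mulrDr lerD //; first by rewrite mulrC ler_pM.
by rewrite ler_pM.
Qed.

Lemma std_part_bounded x y : std_part x y ->
  exists2 C : rat, 0 <= C & `|x| <= ratr C /\ `|y| <= ratr C.
Proof.
move=> h; have [q [hx hy]] := h 1 ltr01; exists (1 + `|q|); first by rewrite addr_ge0.
rewrite !rmorphD /= !ratr_norm; split.
  by rewrite -[x](subrK (ratr q)); apply: le_trans (ler_normD _ _) _; rewrite lerD2r.
by rewrite -[y](subrK (ratr q)); apply: le_trans (ler_normD _ _) _; rewrite lerD2r.
Qed.

Lemma std_partM x x' y y' : std_part x y -> std_part x' y' ->
  std_part (x * x') (y * y').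
Proof.
move=> h h' eps e0.
have [C C0 [xC yC]] := std_part_bounded h.
have [C' C0' [xC' yC']] := std_part_bounded h'.
pose S := C + C' + 1; have S0 : 0 < S by rewrite ltr_wpDl // addr_ge0.
(* This choice gives both [d <= 1] and [d * S <= eps], as [norm_mul_sub] requires. *)
pose d := eps / (S + eps).
have Se : 0 < S + eps by rewrite addr_gt0.
have d0 : 0 < d by rewrite divr_gt0.
have d1 : d <= 1 by rewrite ler_pdivrMr // mul1r lerDr ltW.
have dS : d * S <= eps.
  by rewrite mulrAC ler_pdivrMr // ler_pM2l // lerDl ltW.
have [q [hx hy]] := h _ d0; have [q' [hx' hy']] := h' _ d0.
exists (q * q'); rewrite !rmorphM /=; split.
  apply: (norm_mul_sub xC xC' hx hx'); first by rewrite -(rmorph1 (ratr : rat -> K)) ler_rat.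
  by rewrite -(rmorph1 (ratr : rat -> K)) -!rmorphD -rmorphM ler_rat.
apply: (norm_mul_sub yC yC' hy hy'); first by rewrite -(rmorph1 (ratr : rat -> R)) ler_rat.
by rewrite -(rmorph1 (ratr : rat -> R)) -!rmorphD -rmorphM ler_rat.
Qed.

Lemma std_part_sum (I : Type) (r : seq I) (P : pred I) (f : I -> K) (g : I -> R) :
  (forall i, P i -> std_part (f i) (g i)) ->
  std_part (\sum_(i <- r | P i) f i) (\sum_(i <- r | P i) g i).
Proof.
move=> h; elim/big_rec2: _ => [|i y x Pi]; last by apply: std_partD; exact: h.
by rewrite -(rmorph0 (ratr : rat -> K)) -(rmorph0 (ratr : rat -> R)); exact: std_part_rat.
Qed.

Lemma std_part_rat_eq (q : rat) (y : R) : std_part (ratr q) y -> y = ratr q.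
Proof.
move=> h; apply/eqP; rewrite -subr_eq0 -normr_le0 leNgt; apply/negP => d0.
have d2 : 0 < `|y - ratr q| / 2%:R by rewrite divr_gt0.
have [eps] := rat_in_itvoo d2; rewrite in_itv /= ltr0q => /andP[e0 he].
have [p [hx hy]] := h _ e0.
have hx' : `|ratr p - ratr q : R| <= ratr eps.
  by rewrite -rmorphB -ratr_norm ler_rat -(ler_rat K) ratr_norm rmorphB distrC.
have : `|y - ratr q| <= ratr eps + ratr eps.
  by rewrite -[y](subrK (ratr p)) -addrA; apply: le_trans (ler_normD _ _) _; apply: lerD.
move: he; rewrite ltr_pdivlMr // mulr2n mulrDr mulr1.
by move=> /lt_le_trans h1 /h1; rewrite ltxx.
Qed.

(** The standard part is the supremum in [R] of the rationals that lie below [x] in [K]. *)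
Lemma std_part_ex (x : K) (B : nat) : 0 <= x <= B%:R -> exists y : R, std_part x y.
Proof.
move=> /andP[x0 xB].
pose S : set R := [set y | exists2 q : rat, ratr q <= x & y = ratr q]%classic.
have S_ub (p : rat) : x < ratr p -> forall y, S y -> y <= ratr p.
  move=> xp _ [q qx ->]; rewrite ler_rat -(ler_rat K).
  exact/ltW/(le_lt_trans qx xp).
have S0 : nonempty S by exists (ratr 0); exists 0 => //; rewrite rmorph0.
have hS : has_sup S.
  split => //; exists (ratr B.+1%:R); apply: S_ub; rewrite ratr_nat.
  by apply: le_lt_trans xB _; rewrite ltr_nat.
exists (sup S) => eps e0.
(* The approximation is the grid point [k * eps] just below [x], found with the least [k] such that
   [x < (k + 1) * eps]. *)
have ex : exists k, x < ratr (k.+1%:R * eps).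
  have [k hk] : exists k : nat, B%:R / eps < k%:R.
    exists (Num.bound (B%:R / eps)); apply: le_lt_trans (archi_boundP _) => //.
    by rewrite divr_ge0 // ltW.
  exists k; apply: le_lt_trans xB _; rewrite -ratr_nat ltr_rat.
  rewrite ltr_pdivrMr // in hk; apply: lt_le_trans hk _.
  by rewrite ler_pM2r // ler_nat.
case: (ex_minnP ex) => k xk min_k.
have kx : ratr (k%:R * eps) <= x.
  case: k {xk} min_k => [|k] min_k; first by rewrite mul0r rmorph0.
  by rewrite leNgt; apply/negP => /min_k; rewrite ltnn.
exists (k%:R * eps).
have E : ratr (k.+1%:R * eps) = ratr (k%:R * eps) + ratr eps :> K.
  by rewrite -rmorphD -[k.+1]addn1 natrD mulrDl mul1r.
have E' : ratr (k.+1%:R * eps) = ratr (k%:R * eps) + ratr eps :> R.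
  by rewrite -rmorphD -[k.+1]addn1 natrD mulrDl mul1r.
split.
  rewrite ger0_norm ?subr_ge0 // lerBlDl -E; exact: ltW.
rewrite ger0_norm ?subr_ge0; last first.
  by apply: sup_upper_bound => //; exists (k%:R * eps).
by rewrite lerBlDl -E'; apply: ge_sup => // y; exact: S_ub.
Qed.

Lemma std_part_seq (s : seq K) (B : nat) : (forall x, x \in s -> 0 <= x <= B%:R) ->
  exists2 s' : seq R, size s' = size s & forall i, std_part s`_i s'`_i.
Proof.
elim: s => [|x s IH] h.
  exists [::] => // i; rewrite !nth_nil.
  by rewrite -(rmorph0 (ratr : rat -> K)) -(rmorph0 (ratr : rat -> R)); exact: std_part_rat.
have [|s' sz hs'] := IH; first by move=> y ys; apply: h; rewrite inE ys orbT.
have [y xy] := std_part_ex (h x (mem_head _ _)).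
exists (y :: s'); first by rewrite /= sz.
by case.
Qed.

Lemma std_part_prod_XsubC (s : seq K) (s' : seq R) : size s' = size s ->
  (forall i, std_part s`_i s'`_i) ->
  forall i, std_part (\prod_(z <- s) ('X - z%:P))`_i (\prod_(z <- s') ('X - z%:P))`_i.
Proof.
elim: s s' => [|x s IH] [|y s'] //= => [_ _ i|[sz] h i].
  rewrite !big_nil !coefC; case: (i == 0)%N.
    by rewrite -(rmorph1 (ratr : rat -> K)) -(rmorph1 (ratr : rat -> R)); exact: std_part_rat.
  by rewrite -(rmorph0 (ratr : rat -> K)) -(rmorph0 (ratr : rat -> R)); exact: std_part_rat.
have {}IH := IH _ sz (fun i => h i.+1).
rewrite !big_cons !mulrBl !coefB !coefXM !coefCM.
apply: std_partD; last by apply/std_partN/std_partM => //; exact: (h 0%N).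
case: i => [|i] //=.
by rewrite -(rmorph0 (ratr : rat -> K)) -(rmorph0 (ratr : rat -> R)); exact: std_part_rat.
Qed.

(** Coefficients are polynomials in the roots, so standard parts commute with expanding the product,
    and an integer is its own standard part. *)
Lemma std_part_roots (p : {poly int}) (s : seq K) (s' : seq R) : size s' = size s ->
  (forall i, std_part s`_i s'`_i) ->
  map_poly intr p = \prod_(z <- s) ('X - z%:P) ->
  map_poly intr p = \prod_(z <- s') ('X - z%:P).
Proof.
move=> sz h Ep; apply/polyP => i; apply/esym.
have := std_part_prod_XsubC sz h i; rewrite -Ep !coef_map /= -ratr_int.
by move/std_part_rat_eq => ->; rewrite ratr_int.
Qed.

(** A positive [x] with standard part at most 0 would be infinitesimal, which an algebraic number
    cannot be. This carries inequalities from [R] back to [K]. *)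
Lemma std_part_le0 (x : K) (y : R) : std_part x y -> y <= 0 ->
  algebraicOver (ratr : rat -> K) x -> x <= 0.
Proof.
move=> h y0 alg; rewrite leNgt; apply/negP => x0.
have [q q0 qx] := algebraic_rat_lower_bound alg x0.
have q2 : 0 < q / 2%:R by rewrite divr_gt0.
have [p [hx hy]] := h _ q2.
have p1 : p <= q / 2%:R.
  rewrite -(ler_rat R); move: hy; rewrite ler_norml => /andP[hy _].
  by move: hy y0; lra.
have : x <= ratr (q / 2%:R + p).
  by rewrite rmorphD /= -lerBlDr; apply: le_trans (ler_norm _) hx.
have : ratr (q / 2%:R + p) <= ratr q :> K by rewrite ler_rat; lra.
by move: qx; lra.
Qed.

End StandardPart.

(** * Laplacian spectra of graphs *)

Section Graph.
Variables (n : nat) (e : rel 'I_n).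
Hypotheses (e_sym : symmetric e) (e_irr : irreflexive e).

Lemma degE i : deg e i = (\sum_j e i j)%N.
Proof. by rewrite /deg -sum1dep_card big_mkcond /=; apply: eq_bigr => j _; case: (e i j). Qed.

Lemma laplacianE (F : nzRingType) i j :
  laplacian F e i j = (\sum_k (e i k)%:R) *+ (i == j) - (e i j)%:R.
Proof.
rewrite mxE degE -natr_sum; case: eqP => [->|_]; last by rewrite mulr0n sub0r.
by rewrite e_irr subr0 mulr1n.
Qed.

Lemma sum_deg : (\sum_i deg e i = (num_edges e).*2)%N.
Proof.
have -> : num_edges e = (\sum_(i < n) \sum_(j < n) ((i < j) && e i j))%N.
  rewrite pair_big /= /num_edges -sum1dep_card big_mkcond /=.
  by apply: eq_bigr => p _; case: (_ && _).
rewrite -addnn {2}exchange_big /= -big_split /=; apply: eq_bigr => i _.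
rewrite degE -big_split /=; apply: eq_bigr => j _.
rewrite (e_sym j i); case: (ltngtP i j) => [||/val_inj->] //=; rewrite ?addn0 //.
by rewrite e_irr.
Qed.

Lemma mxtrace_laplacian (F : nzRingType) :
  \tr (laplacian F e) = (num_edges e).*2%:R.
Proof.
by rewrite -sum_deg natr_sum; apply: eq_bigr => i _; rewrite mxE eqxx.
Qed.

Lemma laplacian_csum (F : nzRingType) j : \sum_i laplacian F e i j = 0.
Proof.
under eq_bigr do rewrite laplacianE.
rewrite sumrB [X in X - _](bigD1 j) //= eqxx mulr1n [X in _ + X - _]big1 ?addr0; last first.
  by move=> i /negPf ->.
by apply/eqP; rewrite subr_eq0; apply/eqP/eq_bigr => k _; rewrite e_sym.
Qed.

Lemma ones_laplacian (F : nzRingType) : const_mx 1 *m laplacian F e = 0 :> 'rV_n.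
Proof.
apply/matrixP => i j; rewrite !mxE -[RHS](laplacian_csum F j).
by apply: eq_bigr => k _; rewrite mxE mul1r.
Qed.

(** The lower bound is the M-matrix bound for the Laplacian with unit weights. For the upper bound,
    a root above [n] is nonzero, hence also a root for the Laplacian plus the all-ones matrix, which
    is [n] minus the Laplacian of the complement. *)
Lemma laplacian_root_bounds (F : realFieldType) (z : F) :
  root (char_poly (laplacian F e)) z -> 0 <= z <= n%:R.
Proof.
move=> rz.
have ones_ge0 : 0 <= z.
  apply: root_char_poly_ge0 rz => x x0.
  apply: lt_le_trans (exprn_gt0 n x0) _; apply: (@det_mmatrix_ge _ _ _ (fun=> 1)) => //.
    by move=> i j /negPf ij; rewrite laplacianE ij sub0r oppr_le0.
  move=> j; under eq_bigr do rewrite mul1r.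
  by rewrite laplacian_csum.
rewrite ones_ge0 /= leNgt; apply/negP => zn.
pose u : 'rV[F]_n := const_mx 1; pose c : 'cV[F]_n := const_mx 1.
have := char_poly_rank1 c (mu := 0) (M := laplacian F e) (u := u).
rewrite ones_laplacian scale0r.
move=> /(_ erefl)/(congr1 (horner^~ z)); rewrite !hornerM (eqP rz) mul0r.
move/eqP; rewrite mulf_eq0 hornerXsubC subr0 => /orP[|/eqP z0]; last first.
  by move: zn; rewrite z0 ltNge ler0n.
(* [Lc] is the Laplacian of the complementary graph. *)
pose Lc := n%:R%:M - const_mx 1 - laplacian F e.
rewrite horner_char_poly.
have -> : z%:M - (laplacian F e + c *m u) = (z - n%:R)%:M + Lc.
  have -> : c *m u = const_mx 1.
    by apply/matrixP => i j; rewrite !mxE big_ord1 !mxE mulr1.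
  by rewrite raddfB /= /Lc !addrA subrK opprD addrA addrAC.
have zn' : 0 < z - n%:R by rewrite subr_gt0.
rewrite gt_eqF //; apply: lt_le_trans (exprn_gt0 n zn') _.
apply: (@det_mmatrix_ge _ _ _ (fun=> 1)) => // [i j /negPf ij|j].
  rewrite 3!mxE [(- laplacian F e) i j]mxE laplacianE !mxE ij !mulr0n !sub0r opprK.
  by case: (e i j); rewrite ?subrr ?addNr // addr0 oppr_le0.
have -> : \sum_i 1 * Lc i j = \sum_i ((n%:R *+ (i == j) - 1) - laplacian F e i j).
  by apply: eq_bigr => i _; rewrite mul1r !mxE.
rewrite sumrB laplacian_csum subr0 sumrB sumr_const card_ord.
rewrite (bigD1 j) //= eqxx mulr1n big1 ?addr0 ?subrr // => i /negPf -> //.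
Qed.

Lemma map_laplacian (F : nzRingType) : map_mx intr (laplacian int e) = laplacian F e.
Proof.
apply/matrixP => i j; rewrite !mxE; case: (i == j); first by rewrite rmorph_nat.
by rewrite rmorphN /= rmorph_nat.
Qed.

(** * Split graphs: passage to block form and the bound on top eigenvalue sums *)

Variable A : {set 'I_n}.
Hypotheses (cliqueA : forall x y, x \in A -> y \in A -> x != y -> e x y)
           (indepA : forall x y, x \notin A -> y \notin A -> ~~ e x y).

Definition cross_adj (i : 'I_#|A|) (j : 'I_#|~: A|) : bool := e (enum_val i) (enum_val j).

Definition split_index (x : 'I_(#|A| + #|~: A|)) : 'I_n :=
  match split x with inl i => enum_val i | inr j => enum_val j end.

Lemma split_indexl i : split_index (lshift _ i) = enum_val i.
Proof. by rewrite /split_index -[lshift _ i]/(unsplit (inl i)) unsplitK. Qed.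

Lemma split_indexr j : split_index (rshift _ j) = enum_val j.
Proof. by rewrite /split_index -[rshift _ j]/(unsplit (inr j)) unsplitK. Qed.

Lemma split_index_bij : bijective split_index.
Proof.
apply: inj_card_bij; last by rewrite !card_ord cardsC card_ord.
have disj (i : 'I_#|A|) (j : 'I_#|~: A|) : enum_val i <> enum_val j.
  by move=> E; have := enum_valP j; rewrite -E inE enum_valP.
move=> x y; have [i ->|j ->] := split_ordP x; have [i' ->|j' ->] := split_ordP y;
  rewrite ?split_indexl ?split_indexr.
- by move/enum_val_inj ->.
- by move/disj.
- by move/esym/disj.
- by move/enum_val_inj ->.
Qed.

Lemma split_laplacian_mxsub (F : comNzRingType) :
  mxsub split_index split_index (laplacian F e) = split_laplacian F cross_adj.
Proof.
have disj (i : 'I_#|A|) (j : 'I_#|~: A|) : (enum_val i == enum_val j) = false.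
  by apply/eqP => E; have := enum_valP j; rewrite -E inE enum_valP.
have eAA (i i' : 'I_#|A|) : e (enum_val i) (enum_val i') = (i != i').
  case: eqVneq => [->|ii]; first exact: e_irr.
  by apply: cliqueA; rewrite ?enum_valP // (inj_eq enum_val_inj).
have eBB (j j' : 'I_#|~: A|) : e (enum_val j) (enum_val j') = false.
  apply/negbTE/indepA.
    by have := enum_valP j; rewrite inE.
  by have := enum_valP j'; rewrite inE.
have degh x : (deg e x)%:R = \sum_(i < #|A|) (e x (enum_val i))%:R
    + \sum_(j < #|~: A|) (e x (enum_val j))%:R :> F.
  rewrite degE natr_sum (reindex split_index) /=; last exact/onW_bij/split_index_bij.
  rewrite big_split_ord /=; congr (_ + _); apply: eq_bigr => i _.
    by rewrite split_indexl.
  by rewrite split_indexr.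
rewrite /split_laplacian -[LHS]submxK; congr block_mx; apply/matrixP => i j;
  rewrite !mxE ?split_indexl ?split_indexr.
- rewrite (inj_eq enum_val_inj) eAA; case: eqVneq => [->|_]; last first.
    by rewrite !mulr0n sub0r addr0.
  rewrite degh !mulr1n; congr (_ + _).
  have -> : #|A|%:R - 1 = \sum_(k < #|A|) (1 - (j == k)%:R) :> F.
    rewrite sumrB sumr_const card_ord; congr (_ - _).
    by rewrite (bigD1 j) //= eqxx big1 ?addr0 // => k; rewrite eq_sym => /negPf ->.
  apply: eq_bigr => k _; rewrite eAA.
  by case: (j == k); rewrite ?subrr ?subr0.
- by rewrite disj.
- by rewrite eq_sym disj e_sym.
- rewrite (inj_eq enum_val_inj) eBB oppr0; case: eqVneq => [->|_] //.
  rewrite degh mulr1n [X in _ + X]big1 ?addr0; last by move=> k _; rewrite eBB.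
  by apply: eq_bigr => k _; rewrite e_sym.
Qed.

(** Both sides are the trace of the Laplacian, read off once from the graph and once from the block
    form. *)
Lemma split_num_edges :
  ((num_edges e).*2 = #|A| * (#|A|).-1 + (\sum_i \sum_j cross_adj i j).*2)%N.
Proof.
apply/eqP; rewrite -(eqr_nat int); apply/eqP.
rewrite -mxtrace_laplacian /mxtrace.
rewrite (reindex split_index) /=; last exact/onW_bij/split_index_bij.
have -> : \sum_i laplacian int e (split_index i) (split_index i)
    = \tr (split_laplacian int cross_adj).
  by rewrite -split_laplacian_mxsub; apply: eq_bigr => i _; rewrite [in RHS]mxE.
rewrite mxtrace_block !raddfD /= raddfN /= mxtrace_scalar !mxtrace_diag.
have -> : \tr (const_mx 1 : 'M[int]_#|A|) = #|A|%:R.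
  by rewrite /mxtrace; under eq_bigr do rewrite mxE; rewrite sumr_const card_ord.
have E1 : \sum_i (\row_i \sum_j (cross_adj i j)%:R : 'rV[int]_#|A|) 0 i
    = (\sum_i \sum_j cross_adj i j)%N%:R.
  by rewrite natr_sum; apply: eq_bigr => i _; rewrite mxE natr_sum.
have E2 : \sum_j (\row_j \sum_i (cross_adj i j)%:R : 'rV[int]_#|~: A|) 0 j
    = (\sum_i \sum_j cross_adj i j)%N%:R.
  by rewrite exchange_big natr_sum; apply: eq_bigr => i _; rewrite mxE natr_sum.
rewrite E1 E2 -addnn !natrD -!addrA addrA; congr (_ + _).
case: #|A| => [|a] //; rewrite -mulr_natr natrM /= -addn1 !natrD.
ring.
Qed.

(** The eigenvalues are replaced by their standard parts in the reals, where [split_laplacian_bound]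
    applies. The resulting inequality returns to [K] because both of its sides are algebraic. *)
Lemma split_topk (K : rcfType) (s : seq K) : lap_spectrum e s ->
  forall k, (k <= n)%N ->
  \sum_(i < k) s`_i <= (\sum_i \sum_j cross_adj i j + #|A| * k)%N%:R.
Proof.
move=> [sz _ Es] k kn; set r := (\sum_i _)%N; set a := #|A|.
have [|s' sz' hs] := std_part_seq Rdefinitions.R (s := s) (B := n).
  move=> x xs; apply: laplacian_root_bounds; by rewrite Es root_prod_XsubC.
pose p := char_poly (laplacian int e).
have pE (F : comNzRingType) : map_poly intr p = char_poly (laplacian F e).
  by rewrite map_char_poly map_laplacian.
have Es' : char_poly (laplacian Rdefinitions.R e) = \prod_(z <- s') ('X - z%:P).
  by rewrite -pE; apply: std_part_roots sz' hs _; rewrite pE.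
have bnd : \sum_(z <- s') Num.max (z - a%:R) 0 <= r%:R.
  have := split_laplacian_bound (N := cross_adj) (s := s').
  rewrite -split_laplacian_mxsub (char_poly_mxsub _ split_index_bij) => /(_ Es').
  congr (_ <= _); rewrite natr_sum; apply: eq_bigr => i _.
  by rewrite natr_sum.
(* Any [k] of the differences add up to at most the sum of all positive parts. *)
have bnd' : \sum_(i < k) (s'`_i - a%:R) - r%:R <= 0.
  rewrite subr_le0; apply: le_trans bnd.
  rewrite (big_nth 0) sz' sz big_mkord (big_ord_widen n (fun i => s'`_i - a%:R) kn).
  rewrite big_mkcond /=; apply: ler_sum => i _.
  by case: ifP => _; rewrite le_max lexx ?orbT.
have st_nat m : std_part (m%:R : K) (m%:R : Rdefinitions.R).
  by rewrite -(ratr_nat K m) -(ratr_nat Rdefinitions.R m); exact: std_part_rat.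
have st : std_part (\sum_(i < k) (s`_i - a%:R) - r%:R)
                   (\sum_(i < k) (s'`_i - a%:R) - r%:R).
  apply: std_partD; last exact: std_partN.
  by apply: std_part_sum => i _; apply: std_partD => //; exact: std_partN.
have alg_s x : x \in s -> algebraicOver (ratr : rat -> K) x.
  move=> xs; exists (map_poly intr p).
    by rewrite pE monic_neq0 // char_poly_monic.
  rewrite -map_poly_comp (eq_map_poly (ratr_int K)) pE Es root_prod_XsubC //.
have alg_nat m : algebraicOver (ratr : rat -> K) m%:R.
  by rewrite -(ratr_nat K m); exact: algebraic_id.
have := std_part_le0 st bnd'.
rewrite sumrB sumr_const card_ord -mulrnA subr_le0 lerBlDr -natrD; apply.
apply: algebraic_sub => //; apply: algebraic_sub => //.
elim/big_ind: _ => [||i _]; [exact: algebraic0| exact: algebraic_add|].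
by apply: alg_s; rewrite mem_nth // sz; apply: leq_trans kn.
Qed.

End Graph.

(** * Threshold graphs *)

Lemma char_poly_addC (F : comNzRingType) (n : nat) (M : 'M[F]_n) (c : F) :
  char_poly (M + c%:M) = char_poly M \Po ('X - c%:P).
Proof.
rewrite /char_poly -det_map_mx; congr (\det _); apply/matrixP => i j.
rewrite !mxE rmorphB rmorphMn /= comp_polyX comp_polyC polyCD polyCMn.
by rewrite mulrnBl opprD addrA addrAC.
Qed.

Lemma char_poly_addC_split (F : comNzRingType) (n : nat) (M : 'M[F]_n) (c : F) (s : seq F) :
  char_poly M = \prod_(z <- s) ('X - z%:P) ->
  char_poly (M + c%:M) = \prod_(z <- s) ('X - (z + c)%:P).
Proof.
move=> E; rewrite char_poly_addC E rmorph_prod /=; apply: eq_bigr => z _.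
by rewrite rmorphB /= comp_polyX comp_polyC polyCD opprD addrA addrAC.
Qed.

(* A word [l] lists the choices made for the nodes [size l], ..., 2, 1 in this order;
   node 0 comes first and its choice is irrelevant. *)
Fixpoint choice_of (l : seq bool) (i : nat) : bool :=
  if l is x :: l' then if i == (size l').+1 then x else choice_of l' i else false.

(** Defined on natural numbers so that a word and its extension can be compared without casts. *)
Definition tadj (l : seq bool) (x y : nat) : bool :=
  (x != y) && (if (x < y)%N then choice_of l y else choice_of l x).

Definition tgraph (l : seq bool) : rel 'I_(size l).+1 := fun x y => tadj l x y.

(* The Laplacian spectrum of [tgraph l] without one eigenvalue 0. *)
Fixpoint tspec (l : seq bool) : seq nat :=
  if l is x :: l' then
    if x then (size l').+2 :: map S (tspec l') else 0%N :: tspec l'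
  else [::].

Lemma size_tspec l : size (tspec l) = size l.
Proof. by elim: l => [|[] l IH] //=; rewrite ?size_map IH. Qed.

Lemma tgraph_sym l : symmetric (@tgraph l).
Proof.
move=> x y; rewrite /tgraph /tadj eq_sym.
by case: (ltngtP x y) => //= ->.
Qed.

Lemma tgraph_irr l : irreflexive (@tgraph l).
Proof. by move=> x; rewrite /tgraph /tadj eqxx. Qed.

Lemma tgraph_threshold l : is_threshold (@tgraph l).
Proof.
exists (@nat_of_ord _), (fun x => choice_of l x); split; first exact: val_inj.
by move=> x y; rewrite /tgraph /tadj.
Qed.

Lemma tadj_cons x l i j : (i <= size l)%N -> (j <= size l)%N ->
  tadj (x :: l) i j = tadj l i j.
Proof.
move=> il jl; rewrite /tadj /=.
by rewrite (ltn_eqF (n := (size l).+1)) // (ltn_eqF (n := (size l).+1)).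
Qed.

Lemma tadj_last x l i : (i <= size l)%N -> tadj (x :: l) i (size l).+1 = x.
Proof. by move=> il; rewrite /tadj /= eqxx ltnS il ltn_eqF. Qed.

Lemma tadj_lastl x l i : (i <= size l)%N -> tadj (x :: l) (size l).+1 i = x.
Proof. by move=> il; rewrite /tadj /= eqxx gtn_eqF // ltnNge (leqW il). Qed.

(** Induction on the last added node. An isolated node contributes an eigenvalue 0; a dominating one
    raises the old eigenvalues by 1, except for one 0, and contributes the new number of nodes. *)
Lemma tgraph_char_poly (F : idomainType) l :
  char_poly (laplacian F (@tgraph l)) = \prod_(z <- 0%N :: tspec l) ('X - z%:R%:P).
Proof.
elim: l => [|x l IH].
  rewrite big_seq1 /char_poly det_mx11 !mxE eqxx /deg.
  rewrite (_ : [set _ | _] = set0) ?cards0 //.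
  by apply/setP => j; rewrite !inE ord1 tgraph_irr.
set p := (size l).+1 in IH *.
pose h := cast_ord (addn1 p).
have bij_h : bijective h by exists (cast_ord (esym (addn1 p))) => i; rewrite /h ?cast_ordK ?cast_ordKV.
pose e := @tgraph (x :: l); pose L := laplacian F e; pose L0 := laplacian F (@tgraph l).
have es : symmetric e by exact: tgraph_sym.
have ei : irreflexive e by exact: tgraph_irr.
have hl i : h (lshift 1 i) = i :> nat by [].
have hr i : h (rshift p i) = p :> nat by rewrite /= ord1 addn0.
have Ell i j : e (h (lshift 1 i)) (h (lshift 1 j)) = @tgraph l i j.
  by rewrite /e /tgraph !hl tadj_cons // -ltnS.
have Elr i j : e (h (lshift 1 i)) (h (rshift p j)) = x.
  by rewrite /e /tgraph hl hr tadj_last // -ltnS.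
have Erl i j : e (h (rshift p i)) (h (lshift 1 j)) = x.
  by rewrite /e /tgraph hl hr tadj_lastl // -ltnS.
have sumh (f : 'I_p.+1 -> F) : \sum_k f k
    = \sum_i f (h (lshift 1 i)) + f (h (rshift p 0)).
  rewrite (reindex h) /=; last exact/onW_bij.
  by rewrite big_split_ord big_ord1.
have EL : mxsub h h L = block_mx (L0 + x%:R%:M) (- const_mx x%:R)
     (- const_mx x%:R) (p * x)%N%:R%:M.
  rewrite -[LHS]submxK; congr block_mx; apply/matrixP => i j.
  - rewrite 3!mxE [RHS]mxE /L /L0 !laplacianE //; last exact: tgraph_irr.
    rewrite Ell sumh Elr mxE addrAC -mulrnDl (inj_eq (bij_inj bij_h)).
    rewrite (inj_eq (@lshift_inj _ _)); congr (_ *+ _ - _).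
    by congr (_ + _); apply: eq_bigr => k _; rewrite Ell.
  - by rewrite 3!mxE /L laplacianE // Elr (inj_eq (bij_inj bij_h)) eq_lrshift mulr0n sub0r !mxE.
  - by rewrite 3!mxE /L laplacianE // Erl (inj_eq (bij_inj bij_h)) eq_rlshift mulr0n sub0r !mxE.
  - rewrite 3!mxE /L laplacianE // !ord1 !eqxx ei subr0 mulr1n sumh ei addr0 !mxE eqxx mulr1n.
    under eq_bigr do rewrite Erl.
    by rewrite sumr_const card_ord natrM mulr_natl.
rewrite -(char_poly_mxsub L bij_h) EL; clear EL Erl Elr Ell ei es L e.
have char11 (c : F) : char_poly (c%:M : 'M_1) = 'X - c%:P.
  by rewrite /char_poly det_mx11 !mxE eqxx !mulr1n.
case: x => /=; last first.
  rewrite muln0 (_ : - const_mx _ = 0); last by apply/matrixP => i j; rewrite !mxE oppr0.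
  rewrite (_ : - const_mx _ = 0); last by apply/matrixP => i j; rewrite !mxE oppr0.
  by rewrite char_poly_ublock char11 raddf0 addr0 IH [RHS]big_cons mulrC.
rewrite muln1; set M := block_mx _ _ _ _.
(* Adding the all-ones row to the row of the dominating node makes the matrix block triangular and
   moves its eigenvalue 0 to 1. *)
pose u : 'rV[F]_(p + 1) := const_mx 1; pose c : 'cV[F]_(p + 1) := col_mx 0 1%:M.
have Eu : u = row_mx (const_mx 1) 1%:M.
  rewrite /u -row_mx_const; congr row_mx.
  by apply/matrixP => i j; rewrite !mxE !ord1 eqxx.
have uM : u *m M = 0 *: u.
  rewrite scale0r Eu /M mul_row_block mulmxDr ones_laplacian; last exact: tgraph_irr.
    rewrite add0r mulmx1 !mul1mx subrr -row_mx0; congr row_mx.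
    apply/matrixP => i j; rewrite !mxE !ord1 eqxx mulr1n.
    rewrite (eq_bigr (fun=> -1)); last by move=> k _; rewrite !mxE mul1r.
    by rewrite sumr_const card_ord mulNrn addNr.
  exact: tgraph_sym.
have := char_poly_rank1 c uM.
have -> : (u *m c) 0 0 = 1.
  by rewrite Eu mul_row_col mulmx0 add0r mulmx1 mxE eqxx.
have -> : M + c *m u = block_mx (L0 + 1%:M) (- const_mx 1) 0 p.+1%:R%:M.
  rewrite Eu mul_col_row !mul0mx !mul1mx add_block_mx !addr0 addNr.
  by rewrite -raddfD /= natr1.
rewrite char_poly_ublock char11 add0r.
rewrite (@char_poly_addC_split _ _ _ _ [seq z%:R | z <- 0%N :: tspec l]); last first.
  by rewrite IH big_map.
rewrite big_map big_cons add0r => E.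
(* The common factor [X - 1] comes on one side from the moved eigenvalue and on the other from the 0
   of the smaller graph, raised by 1. *)
have nz : 'X - 1%:P != 0 :> {poly F} by rewrite polyXsubC_eq0.
apply: (mulIf nz); rewrite -E !big_cons big_map.
under [in RHS]eq_bigr do rewrite -natr1.
move: ('X - 1%:P) ('X - 0%:P) ('X - p.+1%:R%:P) (\prod_(i <- tspec l) _) => y1 y2 y3 y4.
ring.
Qed.

(** Exchange argument on the maximum [x] of [s]. If [x] lies in [u], it is removed from both;
    otherwise the first element of [u] is compared with [x] and handed over to the complement
    [v]. *)
Lemma sum_le_sorted (K : realDomainType) (s u v : seq K) :
  sorted (fun x y => y <= x) s -> perm_eq s (u ++ v) ->
  \sum_(z <- u) z <= \sum_(i < size u) s`_i.
Proof.
have tr : transitive (fun x y : K => y <= x) by move=> y x z h1 h2; apply: le_trans h1.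
elim: s u v => [|x s IH] u v.
  move=> _ /perm_size; rewrite size_cat /= => /esym/eqP; rewrite addn_eq0 => /andP[/eqP/size0nil -> _].
  by rewrite big_nil big_ord0.
move=> /= xs; have /allP xmax := order_path_min tr xs.
have {}IH := IH _ _ (path_sorted xs).
move=> pu; have [xu|xu] := boolP (x \in u).
  rewrite (perm_big _ (perm_to_rem xu)) (perm_size (perm_to_rem xu)) big_cons /=.
  rewrite big_ord_recl /= lerD2l; apply: (IH _ v).
  rewrite -(perm_cons x); apply: perm_trans pu _.
  by rewrite -cat_cons perm_cat2r perm_to_rem.
case: u pu xu => [|y u] pu; first by rewrite big_nil big_ord0.
rewrite inE negb_or => /andP[xy xu].
have xv : x \in v.
  have := mem_head x s; rewrite (perm_mem pu) mem_cat inE (negPf xy) (negPf xu) //.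
have ys : y \in s.
  have : y \in x :: s by rewrite (perm_mem pu) mem_head.
  by rewrite inE eq_sym (negPf xy).
rewrite big_cons big_ord_recl /= lerD ?xmax //; apply: (IH _ (y :: rem x v)).
rewrite -(perm_cons x); apply: perm_trans pu _.
apply: (@perm_trans _ (y :: u ++ x :: rem x v)).
  by rewrite /= perm_cons perm_cat2l perm_to_rem.
by apply/seq.permP => q; rewrite /= !count_cat /=; lia.
Qed.

(** Any choice [u] of eigenvalues bounds the top sum from below, so the spectra of the extremal
    graphs never have to be sorted explicitly. *)
Lemma tgraph_topk (K : rcfType) (l : seq bool) :
  exists lT : seq K, [/\ lap_spectrum (@tgraph l) lT,
    (num_edges (@tgraph l)).*2 = sumn (tspec l) &
    forall u v, perm_eq (0%N :: tspec l) (u ++ v) ->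
      (sumn u)%:R <= \sum_(i < size u) lT`_i].
Proof.
pose s : seq K := [seq z%:R | z <- 0%N :: tspec l].
have Es : char_poly (laplacian K (@tgraph l)) = \prod_(z <- s) ('X - z%:P).
  by rewrite tgraph_char_poly big_map.
exists (sort (fun x y => y <= x) s); split.
- split.
  + by rewrite size_sort size_map /= size_tspec.
  + by apply: sort_sorted => x y; rewrite le_total.
  + by rewrite Es; apply: perm_big; rewrite perm_sym perm_sort.
- apply/eqP; rewrite -(eqr_nat K) -mxtrace_laplacian; [|exact: tgraph_sym|exact: tgraph_irr].
  by rewrite -(sum_roots_char_poly Es) big_map big_cons add0r sumnE natr_sum.
- move=> u v puv.
  have -> : (sumn u)%:R = \sum_(z <- [seq w%:R | w <- u]) z :> K.
    by rewrite big_map sumnE natr_sum.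
  rewrite -(size_map (fun w : nat => w%:R : K) u).
  apply: (@sum_le_sorted _ _ _ [seq w%:R | w <- v]).
    by apply: sort_sorted => x y; rewrite le_total.
  rewrite -map_cat perm_sort; exact: perm_map.
Qed.

(** Every later dominating node raises the eigenvalues contributed before it, so all [k] new ones
    end at the final number of nodes. *)
Lemma tspec_true k l :
  tspec (nseq k true ++ l) = nseq k (size l + k).+1 ++ map (addn k) (tspec l).
Proof.
elim: k => [|k IH] /=; first by rewrite map_id_in.
rewrite IH size_cat size_nseq map_cat map_nseq -map_comp addnC addnS.
by congr (_ :: _ ++ _).
Qed.

Lemma tspec_false k l : tspec (nseq k false ++ l) = nseq k 0%N ++ tspec l.
Proof. by elim: k => //= k ->. Qed.

(** Greedy choice: the last node is dominating exactly when there are enough edges to join it to all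
    the others. *)
Lemma tspec_exists (p m : nat) : (m.*2 <= p * p.+1)%N ->
  exists2 l, size l = p & sumn (tspec l) = m.*2.
Proof.
elim: p m => [|p IH] m hm; first by exists [::] => //=; lia.
have [pm|pm] := leqP p.+1 m.
  have [|l sl El] := IH (m - p.+1)%N; first by nia.
  exists (true :: l) => /=; first by rewrite sl.
  have -> : sumn (map S (tspec l)) = (sumn (tspec l) + p)%N.
    rewrite -sl -size_tspec; elim: (tspec l) => //= *; lia.
  rewrite El sl; lia.
have [|l sl El] := IH m; first by nia.
by exists (false :: l) => /=; rewrite ?sl.
Qed.

(** * Extremal threshold graphs *)

Lemma threshold_witness (K : rcfType) (n m : nat) (l : seq bool) (u v : seq nat) (x : K) :
  (size l).+1 = n -> sumn (tspec l) = m.*2 -> perm_eq (0%N :: tspec l) (u ++ v) ->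
  x <= (sumn u)%:R ->
  exists (t : rel 'I_n) (lT : seq K),
    symmetric t /\ irreflexive t /\ is_threshold t /\
    num_edges t = m /\ lap_spectrum t lT /\ x <= \sum_(i < size u) lT`_i.
Proof.
move=> <- Em puv xu; have [lT [spT mT topT]] := tgraph_topk K l.
exists (@tgraph l), lT; split; first exact: tgraph_sym.
split; first exact: tgraph_irr.
split; first exact: tgraph_threshold.
split; first by apply: double_inj; rewrite mT.
by split=> //; apply: le_trans xu _; exact: topT puv.
Qed.

Lemma num_edges_le (n : nat) (e : rel 'I_n) : symmetric e -> irreflexive e ->
  ((num_edges e).*2 <= n * n.-1)%N.
Proof.
move=> es ei; rewrite -(sum_deg es ei).
have -> : (n * n.-1 = \sum_(i < n) n.-1)%N by rewrite sum_nat_const card_ord.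
apply: leq_sum => i _; rewrite /deg.
have -> : n.-1 = #|[set~ i]| by rewrite cardsC1 card_ord.
by apply: subset_leq_card; apply/subsetP => j; rewrite !inE; apply: contraTneq => ->; rewrite ei.
Qed.

Lemma sumn_map_addn k s : sumn (map (addn k) s) = (sumn s + k * size s)%N.
Proof. by elim: s => [|x s IH] /=; [rewrite muln0 | rewrite IH; lia]. Qed.


(* The three bounds on [x] are attained respectively by [k] dominating nodes over an
   arbitrary threshold graph, by a threshold graph on [k + 1] nodes padded with isolated
   ones, and by [k] clique nodes joined to [q + 1] independent nodes plus one
   further node with [w] neighbours. *)
Lemma threshold_max (K : rcfType) (n m k : nat) (x : K) :
  (m.*2 <= n * n.-1)%N -> (0 < k <= n)%N ->
  x <= (n * k)%N%:R -> x <= m.*2%:R -> x *+ 2 <= (m.*2 + k * k.+1)%N%:R ->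
  exists (t : rel 'I_n) (lT : seq K),
    symmetric t /\ irreflexive t /\ is_threshold t /\
    num_edges t = m /\ lap_spectrum t lT /\ x <= \sum_(i < k) lT`_i.
Proof.
move=> mle /andP[k0 kn] x_nk x_2m x_mk.
have [Ekn|kn'] := eqVneq k n.
  have [|l sl El] := @tspec_exists n.-1 m; first by case: (n) mle; lia.
  have := @threshold_witness K n m l (0%N :: tspec l) [::] x.
  by rewrite cats0 /= size_tspec sl El prednK ?(leq_trans k0) // -Ekn; apply.
have [p En] : exists p, n = (k + p.+1)%N by exists (n - k.+1)%N; lia.
(* [T] is the number of edges of a clique on [k] nodes. *)
have [T ET] : exists T, (T.*2 + k = k * k)%N.
  exists (k * k.-1)./2; rewrite even_halfK; first by rewrite -mulnSr prednK.
  by case: (k) => // k'; rewrite oddM /= andNb.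
(* There are enough edges for [k] dominating nodes; the remaining edges go among the other [p + 1]
   nodes. *)
have [c1|c1] := leqP (T + k * p.+1) m.
  have [|l sl El] := @tspec_exists p (m - T - k * p.+1)%N.
    by move: mle; rewrite En addnS /=; clear -ET c1; nia.
  have := @threshold_witness K n m (nseq k true ++ l) (nseq k n)
    (0%N :: map (addn k) (tspec l)) x.
  rewrite size_nseq; apply.
  - by rewrite size_cat size_nseq sl; lia.
  - rewrite tspec_true sumn_cat sumn_nseq sumn_map_addn El size_tspec sl.
    by clear -ET c1; nia.
  - rewrite tspec_true sl (_ : (p + k).+1 = n); last by lia.
    by rewrite perm_sym -cat1s perm_catCA.
  - by rewrite sumn_nseq.
(* All edges fit on [k + 1] nodes, whose [k] listed eigenvalues carry the whole trace. *)
have [c2|c2] := leqP m.*2 (k * k.+1)%N.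
  have [l sl El] := tspec_exists c2.
  have := @threshold_witness K n m (nseq p false ++ l) (tspec l) (nseq p.+1 0%N) x.
  rewrite size_tspec sl; apply.
  - by rewrite size_cat size_nseq sl; lia.
  - by rewrite tspec_false sumn_cat sumn_nseq.
  - by rewrite tspec_false -[_ :: _ ++ _]/(nseq p.+1 0%N ++ _) perm_catC.
  - by rewrite El.
have Tk : (T + k <= m)%N by clear -ET c2; nia.
(* The edges outside a [k]-clique fill [q] further nodes with [k] neighbours each, and one node with
   [w]. After the case split below, [q + 1] replaces [q]. *)
pose q := ((m - T) %/ k)%N; pose w := ((m - T) %% k)%N.
have Eqw : (m = T + q * k + w)%N by rewrite -addnA -divn_eq; lia.
have wk : (w < k)%N by rewrite ltn_mod.
have q0 : (0 < q)%N by rewrite divn_gt0 //; lia.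
have qp : (q < p.+1)%N by rewrite ltn_divLR // mulnC; lia.
move: (q) (w) Eqw wk q0 qp => {q w} [//|q] w Eqw wk _ qp.
(* Read from the right: node 0 and [q] more form the independent set, then come [k - w] clique
   nodes, the extra node, the [w] clique nodes joined to it, and isolated padding. *)
pose l := nseq (p - q.+1) false ++ nseq w true ++ false :: nseq (k - w) true ++ nseq q false.
have Espec : tspec l = nseq (p - q.+1) 0%N ++ nseq w (q + k).+2 ++
    w :: nseq (k - w) (q + k).+1 ++ nseq q k.
  rewrite tspec_false tspec_true /= tspec_true -[nseq q false]cats0 tspec_false cats0.
  rewrite !size_cat !size_nseq !map_cat !map_nseq !addn0 subnKC ?(ltnW wk) //.
  by rewrite cats0; congr (_ ++ nseq _ _ ++ _ :: nseq _ _ ++ _); lia.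
have := @threshold_witness K n m l (nseq w (q + k).+2 ++ nseq (k - w) (q + k).+1)
  (nseq (p - q) 0%N ++ w :: nseq q k) x.
rewrite size_cat !size_nseq subnKC ?(ltnW wk) //; apply.
- by rewrite /l !size_cat /= size_cat !size_nseq; lia.
- rewrite Espec !sumn_cat /= sumn_cat !sumn_nseq.
  have [d Ed] : exists d, k = (w + d)%N by exists (k - w)%N; lia.
  by move: ET Eqw; rewrite Ed addKn; clear; nia.
- rewrite Espec; have -> : (p - q = (p - q.+1).+1)%N by lia.
  by apply/seq.permP => f; rewrite /= !count_cat /= !count_cat /=; lia.
- rewrite sumn_cat !sumn_nseq -(ler_pMn2r (n := 2)) //; apply: le_trans x_mk _.
  have [d Ed] : exists d, k = (w + d)%N by exists (k - w)%N; lia.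
  by rewrite -mulrnA ler_nat; move: ET Eqw; rewrite Ed addKn; clear; nia.
Qed.

(** The difference of the two sides is [(a - k)(a - k - 1)], a product of consecutive integers. *)
Lemma clique_bound (a k : nat) : ((a * k).*2 <= a * a.-1 + k * k.+1)%N.
Proof.
have [ak|ka] := leqP a k.
  have [d ->] : exists d, k = (a + d)%N by exists (k - a)%N; lia.
  by case: a {ak} => // a; nia.
have [d ->] : exists d, a = (k + d.+1)%N by exists (a - k.+1)%N; lia.
by rewrite addnS /=; nia.
Qed.

Theorem theorem2 (R : rcfType) (n : nat) (e : rel 'I_n)
    (He_sym : symmetric e) (He_irr : irreflexive e) (Hsplit : is_split e)
    (lG : seq R) (HlG : lap_spectrum e lG) (k : nat)
    (Hk1 : (1 <= k)%N) (Hkn : (k <= n)%N) :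
  exists (t : rel 'I_n) (lT : seq R),
    symmetric t /\ irreflexive t /\ is_threshold t /\
    num_edges t = num_edges e /\ lap_spectrum t lT /\
    \sum_(i < k) lG`_i <= \sum_(i < k) lT`_i.
Proof.
have [A [clA inA]] := Hsplit.
have Em := split_num_edges He_sym He_irr clA inA.
have Htop := split_topk He_sym He_irr clA inA HlG Hkn.
have mle := num_edges_le He_sym He_irr.
move: Em Htop mle; set r := (\sum_i _)%N; set a := #|A|; set m := num_edges e => Em Htop mle.
have [sz _ Echar] := HlG.
have bnd (i : 'I_n) : 0 <= lG`_i <= n%:R.
  apply: (laplacian_root_bounds He_sym He_irr).
  by rewrite Echar root_prod_XsubC mem_nth // sz.
have Htop_nk : \sum_(i < k) lG`_i <= (n * k)%N%:R.
  rewrite natrM mulr_natr -[X in _ *+ X]card_ord -sumr_const; apply: ler_sum => i _.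
  by have /andP[] := bnd (widen_ord Hkn i).
have Htop_2m : \sum_(i < k) lG`_i <= m.*2%:R.
  rewrite -(mxtrace_laplacian He_sym He_irr) -(sum_roots_char_poly Echar).
  rewrite (big_nth 0) sz big_mkord (big_ord_widen n (fun i => lG`_i) Hkn).
  rewrite big_mkcond; apply: ler_sum => i _ /=; case: ifP => // _.
  by have /andP[] := bnd i.
apply: threshold_max => //; first by rewrite Hk1.
(* Since [2m = a(a - 1) + 2r], this turns the bound [r + a k] into [m + k(k + 1)/2]. *)
have := clique_bound a k => h.
rewrite mulr2n; apply: le_trans (lerD Htop Htop) _; rewrite -natrD ler_nat.
by move: Em h; lia.
Qed.
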